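(* Consider a linear fractional-order system $d^\gamma x(t)={\mathbf A}x(t)$ with $1\le\gamma<2$ and ${\mathbf A}$ a real $n\times n$ matrix. Let ${\mathbf A}$ be diagonally ${\mathbb C}^0_\theta$-dominant for $\theta=\pi(1-\frac{\gamma}{2})$. Then the system $d^\gamma x(t)={\mathbf A}x(t)$ is asymptotically stable; moreover, each perturbed system $d^\gamma x(t)=({\mathbf D}{\mathbf A})x(t)$, where ${\mathbf D}$ is an arbitrary positive diagonal matrix, is also asymptotically stable.
   Context: For $\theta\in(0,\pi/2]$, a real matrix $\{a_{ij}\}$ is diagonally ${\mathbb C}^0_\theta$-dominant if $a_{ii}<0$ and $\sin\theta\,|a_{ii}|>\sum_{j\ne i}|a_{ij}|$ for all $i$. A positive diagonal matrix is a diagonal matrix with positive diagonal entries. By a known criterion, the fractional-order system $d^\gamma x(t)={\mathbf A}x(t)$, $x(0)=x_0$, $0<\gamma\le2$, is asymptotically stable if and only if all eigenvalues $\lambda$ of ${\mathbf A}$ are nonzero and satisfy $|\arg(\lambda)|>\gamma\frac{\pi}{2}$ (argument in $(-\pi,\pi]$); asymptotic stability is understood through this criterion. *)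

(* Defs.v *)
From mathcomp Require Import all_boot all_order all_algebra.
From mathcomp Require Import complex.
From mathcomp Require Import reals trigo.

Set Implicit Arguments.
Unset Strict Implicit.
Unset Printing Implicit Defensive.

Import Order.TTheory GRing.Theory Num.Theory.

Local Open Scope ring_scope.
Local Open Scope complex_scope.

(* Principal argument, with values in (-pi, pi]. Its value at 0, where
   0 / 0 = 0, is junk. [cargP] is the polar form that characterizes it. *)
Definition carg (R : realType) (z : R[i]) : R :=
  let: x +i* y := z in
  let t := acos (x / Num.sqrt (x ^+ 2 + y ^+ 2)) in
  if 0 <= y then t else - t.

Lemma cargP (R : realType) (x y : R) : x +i* y != 0 ->
  let r := Num.sqrt (x ^+ 2 + y ^+ 2) in
  [/\ - pi < carg (x +i* y), carg (x +i* y) <= pi,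
      x = r * cos (carg (x +i* y)) & y = r * sin (carg (x +i* y))].
Proof.
move=> z0 r.
have s_ge0 : 0 <= x ^+ 2 + y ^+ 2 by rewrite addr_ge0 ?sqr_ge0.
have s_gt0 : 0 < x ^+ 2 + y ^+ 2.
  rewrite lt_def s_ge0 andbT paddr_eq0 ?sqr_ge0// !sqrf_eq0.
  by rewrite eq_complex /= in z0.
have r_gt0 : 0 < r by rewrite sqrtr_gt0.
have r0 : r != 0 by rewrite gt_eqF.
have rr : r ^+ 2 = x ^+ 2 + y ^+ 2 by rewrite sqr_sqrtr.
have xr1 : `|x / r| <= 1.
  rewrite normrM normfV (gtr0_norm r_gt0) ler_pdivrMr// mul1r.
  by rewrite -sqrtr_sqr ler_sqrt ?addr_ge0 ?sqr_ge0// lerDl sqr_ge0.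
have xrB : -1 <= x / r <= 1 by rewrite -ler_norml.
have cosE : cos (acos (x / r)) = x / r by rewrite acosK// in_itv.
have sinE : sin (acos (x / r)) = `|y| / r.
  rewrite sin_acos//.
  have -> : 1 - (x / r) ^+ 2 = (y / r) ^+ 2.
    rewrite !exprMn !exprVn -[1](@divff _ (r ^+ 2)) ?expf_neq0// -mulrBl.
    by congr (_ * _); rewrite rr addrAC subrr add0r.
  by rewrite sqrtr_sqr normrM normfV (gtr0_norm r_gt0).
have t0 := acos_ge0 xrB; have tpi := acos_lepi xrB.
have pi0 := pi_gt0 R.
rewrite /carg -/r; case: ifPn => [y0|].
  split=> //; first by rewrite (lt_le_trans _ t0)// oppr_lt0.
  - by rewrite cosE mulrC divfK.
  - by rewrite sinE ger0_norm// mulrC divfK.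
rewrite -ltNge => y0; split.
- rewrite ltrN2 lt_neqAle tpi andbT; apply/eqP => tE.
  move: sinE; rewrite tE sinpi => /esym/eqP.
  by rewrite mulf_eq0 invr_eq0 (negbTE r0) orbF normr_eq0 lt_eqF.
- by rewrite (le_trans _ (ltW pi0))// oppr_le0.
- by rewrite cosN cosE mulrC divfK.
- by rewrite sinN sinE ltr0_norm// mulNr opprK mulrC divfK.
Qed.

Definition diag_theta_dominant (R : realType) (n : nat) (theta : R)
    (A : 'M[R]_n) : Prop :=
  forall i : 'I_n,
    A i i < 0 /\ \sum_(j < n | j != i) `|A i j| < sin theta * `|A i i|.

Definition positive_diagonal (R : realType) (n : nat) (D : 'M[R]_n) : Prop :=
  is_diag_mx D /\ forall i : 'I_n, 0 < D i i.

(* Asymptotic stability of the system d^gamma x(t) = A x(t), x(0) = x0, for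
   0 < gamma <= 2, in the sense of the eigenvalue criterion. The spectrum is
   the complex one: A is mapped into 'M[R[i]]_n first. *)
Definition frac_asymptotically_stable (R : realType) (n : nat) (gamma : R)
    (A : 'M[R]_n) : Prop :=
  forall lambda : R[i],
    eigenvalue (map_mx (real_complex R) A) lambda ->
    lambda != 0 /\ gamma * (pi / 2) < `|carg lambda|.

(* Main.v *)
Require Import Defs.
From mathcomp Require Import all_boot all_order all_algebra.
From mathcomp Require Import complex.
From mathcomp Require Import reals trigo.
From mathcomp Require Import ring lra.
Import Order.TTheory GRing.Theory Num.Theory.
Local Open Scope ring_scope.

(** Every eigenvalue of [A] lies in a Gershgorin disc centred at some diagonal
    entry [A i i < 0], and dominance makes the radius of that disc smaller than
    [sin theta * `|A i i|]. This is the distance from [A i i] to the two rays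
    that start at 0 and make the angle [theta] with the negative real axis, so
    for [theta <= pi / 2] the closed disc stays strictly between these rays
    (see [carg_gt_disc]): the eigenvalue is nonzero, and its argument exceeds
    [pi - theta] in absolute value. For [theta = pi * (1 - gamma / 2)] the bound
    [pi - theta] is [gamma * (pi / 2)], the one in the stability criterion.

    Left multiplication by a positive diagonal matrix scales the centre and the
    radius of the disc of a row by the same positive factor, so dominance is
    preserved ([diag_theta_dominantM]) and the perturbed systems are covered by
    the same argument. *)

Lemma eigenvalue_tr (F : fieldType) (n : nat) (A : 'M[F]_n) (a : F) :
  eigenvalue A^T a = eigenvalue A a.
Proof.
rewrite /eigenvalue /eigenspace !kermx_eq0 !row_free_unit -(unitmx_tr (A - _)).
by rewrite linearB /= tr_scalar_mx.
Qed.

(** Row [i] of the eigenvector equation bounds [a - A i i] when [i] is the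
    position of the largest coordinate. Row sums need a right eigenvector, but
    [eigenvalue] speaks of left ones, hence the passage to [A^T]. *)
Lemma gershgorin {F : numFieldType} {n : nat} {A : 'M[F]_n} {a : F} :
  eigenvalue A a ->
  exists i : 'I_n, `|a - A i i| <= \sum_(j < n | j != i) `|A i j|.
Proof.
rewrite -eigenvalue_tr => /eigenvalueP[v vA v_neq0].
have /rV0Pn[i0 vi0] := v_neq0.
case: (@real_arg_maxP _ _ i0 xpredT (fun i => `|v 0 i|)) => [|i _|] //.
  exact: normr_real.
move=> i _ i_max; exists i.
have vi_gt0 : 0 < `|v 0 i| by rewrite (lt_le_trans _ (i_max i0 _))// normr_gt0.
rewrite -(ler_pM2r vi_gt0) -normrM mulr_suml.
have -> : (a - A i i) * v 0 i = \sum_(j < n | j != i) A i j * v 0 j.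
  have /rowP/(_ i) := vA; rewrite !mxE (bigD1 i)//= mxE mulrBl => <-.
  rewrite mulrC addrAC subrr add0r; apply: eq_bigr => j _.
  by rewrite mxE mulrC.
apply: le_trans (ler_norm_sum _ _ _) _; apply: ler_sum => j _.
by rewrite normrM ler_wpM2l//; apply: i_max.
Qed.

(** Write [lambda] in polar form with modulus [r] and argument [phi]. By the law
    of cosines, [`|lambda - a| ^+ 2 = r ^+ 2 + a ^+ 2 - 2 * r * a * cos phi]. If
    [`|phi| <= pi - theta], then [cos phi >= - cos theta], and since [a < 0] the
    right-hand side is at least
    [(r + a * cos theta) ^+ 2 + (sin theta * a) ^+ 2], which is too large for
    [lambda] to lie in the disc. *)
Lemma carg_gt_disc {R : realType} {theta a : R} {lambda : R[i]} :
  0 <= theta <= pi -> a < 0 ->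
  `|lambda - real_complex R a| < real_complex R (sin theta * `|a|) ->
  lambda != 0 /\ pi - theta < `|carg lambda|.
Proof.
case: lambda => x y /andP[theta_ge0 theta_lepi] a_lt0.
rewrite normc_def ltcR /= subr0 ltr0_norm// => lt_r.
have {lt_r} lt_sq : (x - a) ^+ 2 + y ^+ 2 < (sin theta * a) ^+ 2.
  have := lt_r.
  rewrite -(ltr_pXn2r (isT : (0 < 2)%N)) ?nnegrE ?sqrtr_ge0//; last first.
    by apply: le_trans (ltW lt_r); apply: sqrtr_ge0.
  by rewrite sqr_sqrtr ?addr_ge0 ?sqr_ge0// mulrN sqrrN.
have cs := cos2Dsin2 theta.
have lambda_neq0 : Complex x y != 0.
  (* The distance from 0 to [a] is [`|a|], no less than [sin theta * `|a|]. *)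
  apply/eqP => -[x0 y0]; move: lt_sq; rewrite x0 y0.
  have : 0 <= (cos theta * a) ^+ 2 by apply: sqr_ge0.
  nra.
split=> //.
have [arg_gt arg_le xE yE] := cargP lambda_neq0.
set r := Num.sqrt _ in xE yE; set phi := carg _ in arg_gt arg_le xE yE *.
have r_ge0 : 0 <= r by apply: sqrtr_ge0.
rewrite ltNge; apply/negP => phi_le.
have cos_phi : - cos theta <= cos phi.
  rewrite -(cos_norm phi) -(cosN theta) -cosDpi addrC.
  rewrite leNgt ltr_cos ?in_itv /= -?leNgt//.
    by rewrite subr_ge0 theta_lepi lerBlDr lerDl.
  by rewrite normr_ge0 ler_norml arg_le ltW.
have cs' := cos2Dsin2 phi.
have := sqr_ge0 (r + a * cos theta).
have : 0 <= r * - a * (cos phi + cos theta).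
  by apply: mulr_ge0; [apply: mulr_ge0 => //; lra | lra].
move: lt_sq; rewrite xE yE; nra.
Qed.

Lemma diag_theta_dominantM (R : realType) (n : nat) (theta : R)
    (A D : 'M[R]_n) :
  diag_theta_dominant theta A -> positive_diagonal D ->
  diag_theta_dominant theta (D *m A).
Proof.
move=> A_dom [/diag_mxP[d ->] d_gt0] i.
have := d_gt0 i; rewrite mul_diag_mx !mxE eqxx mulr1n => di_gt0.
have [Aii_lt0 sum_lt] := A_dom i; split; first by rewrite pmulr_rlt0.
under eq_bigr do rewrite mxE normrM (gtr0_norm di_gt0).
by rewrite -mulr_sumr normrM (gtr0_norm di_gt0) mulrCA ltr_pM2l.
Qed.

Lemma diag_theta_dominant_eigenvalue (R : realType) (n : nat) (theta : R)
    (A : 'M[R]_n) (lambda : R[i]) :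
  0 <= theta <= pi -> diag_theta_dominant theta A ->
  eigenvalue (map_mx (real_complex R) A) lambda ->
  lambda != 0 /\ pi - theta < `|carg lambda|.
Proof.
move=> theta_pi A_dom /gershgorin [k].
have [Akk_lt0 sum_lt] := A_dom k.
rewrite mxE => disc; apply: (carg_gt_disc theta_pi Akk_lt0).
apply: le_lt_trans disc _; move: sum_lt; rewrite -ltcR rmorph_sum /=.
under [X in _ -> X < _]eq_bigr do
  rewrite mxE normc_def /= expr0n addr0 sqrtr_sqr.
by [].
Qed.

Theorem theorem17 (R : realType) (n : nat) (gamma : R) (A : 'M[R]_n)
    (gamma_ge1 : 1 <= gamma) (gamma_lt2 : gamma < 2)
    (A_dominant : diag_theta_dominant (pi * (1 - gamma / 2)) A) :
  frac_asymptotically_stable gamma A /\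
  (forall D : 'M[R]_n, positive_diagonal D ->
     frac_asymptotically_stable gamma (D *m A)).
Proof.
have pi_gt0 := pi_gt0 R.
have stable B : diag_theta_dominant (pi * (1 - gamma / 2)) B ->
    frac_asymptotically_stable gamma B.
  move=> B_dom lambda.
  have -> : gamma * (pi / 2) = pi - pi * (1 - gamma / 2) by field.
  by apply: diag_theta_dominant_eigenvalue => //; nra.
by split=> [|D D_pos]; apply: stable => //; apply: diag_theta_dominantM.
Qed.
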